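(* A finite field extension $L/K$ is a Galois field extension if and only if $L\rtimes G(L/K)=E(L/K)$.
   Context: The field $K$ has arbitrary characteristic. For a finite field extension $L/K$: $E(L/K)=\mathrm{End}_K(L)$ is the algebra of $K$-linear endomorphisms of $L$; $L$ is viewed as a subfield of $E(L/K)$ via multiplication operators. $G(L/K)=\mathrm{Aut}_{K\text{-alg}}(L)\subseteq E(L/K)$. $L\rtimes G(L/K)=\bigoplus_{g\in G(L/K)}Lg\subseteq E(L/K)$ is the skew group algebra, i.e. the subalgebra of $E(L/K)$ generated by $L$ and $G(L/K)$. *)

(* Defs.v *)
From mathcomp Require Import all_boot all_order all_algebra all_field.

Set Implicit Arguments.
Unset Strict Implicit.
Unset Printing Implicit Defensive.

Import GRing.Theory.
Local Open Scope ring_scope.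

(* The predicate [galois] of the library is only available on a
   [splittingFieldType], where normality over the base field is built in.
   Here [L] is an arbitrary finite extension of [K], so normality is stated
   separately; [galois_extensionE] compares the two notions. *)
Definition normal_extension (K : fieldType) (L : fieldExtType K) : Prop :=
  forall x : L, exists r : seq L, minPoly 1 x = \prod_(y <- r) ('X - y%:P).

Definition galois_extension (K : fieldType) (L : fieldExtType K) : Prop :=
  normal_extension L /\ separable 1 {:L}.

Lemma galois_extensionE (K : fieldType) (L : splittingFieldType K) :
  galois_extension L <-> galois 1 {:L}.
Proof.
split=> [[nL sL] | /and3P[_ sL /normalFieldP nL]].
  apply/and3P; split=> //; first exact: sub1v.
  apply/normalFieldP=> x _; have [r Dr] := nL x; exists r => //.
  by apply/allP=> y _; apply: memvf.
by split=> // x; have [r _ Dr] := nL x (memvf x); exists r.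
Qed.

(* [f] belongs to the sum of the subspaces [L g] of 'End(L), for [g] ranging
   over Aut_K(L) = kAut 1 {:L}; an element [a] of [L] is identified with the
   multiplication operator [amull a].  The product of 'End(L) is composition
   of functions, hence the explicit \o: the ring structure provided by
   [FalgLfun] is the opposite one.  The automorphisms in [s] are pairwise
   distinct; the sum is direct by [skew_group_algebra_direct]. *)
Definition skew_group_algebra (K : fieldType) (L : fieldExtType K)
    (f : 'End(L)) : Prop :=
  exists (s : seq 'End(L)) (a : 'End(L) -> L),
    [/\ uniq s, all (kAut 1 {:L}) s
      & f = \sum_(g <- s) (amull (a g) \o g)%VF].

Inductive generated_subalgebra (K : fieldType) (L : fieldExtType K) :
    'End(L) -> Prop :=
  | gen_mull a : generated_subalgebra (amull a)
  | gen_aut g : kAut 1 {:L} g -> generated_subalgebra g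
  | gen_add f1 f2 : generated_subalgebra f1 -> generated_subalgebra f2 ->
      generated_subalgebra (f1 + f2)
  | gen_comp f1 f2 : generated_subalgebra f1 -> generated_subalgebra f2 ->
      generated_subalgebra (f1 \o f2)%VF.

Section SkewGroupAlgebra.

Variables (K : fieldType) (L : fieldExtType K).
Implicit Types (f g h : 'End(L)) (a : 'End(L) -> L) (s : seq 'End(L)).

Lemma kAut1M g : kAut 1 {:L} g -> {morph g : x y / x * y}.
Proof.
by rewrite kAutfE => /kHom_monoid_morphism[].
Qed.

Lemma kAut1_1 g : kAut 1 {:L} g -> g 1 = 1.
Proof. by rewrite kAutfE => /kHom_monoid_morphism[]. Qed.

Lemma amull_compE c g x : (amull c \o g)%VF x = c * g x.
Proof. by rewrite comp_lfunE lfunE. Qed.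

Lemma skew0 : skew_group_algebra (0 : 'End(L)).
Proof. by exists [::], (fun=> 0); split=> //; rewrite big_nil. Qed.

Lemma skewDt f g c : kAut 1 {:L} g -> skew_group_algebra f ->
  skew_group_algebra (f + (amull c \o g)%VF).
Proof.
move=> Ag [s [a [Us As ->]]].
have amullD x y : amull (x + y) = amull x + amull y :> 'End(L).
  by apply/lfunP=> z; rewrite add_lfunE !lfunE /= mulrDl.
case sg: (g \in s).
  exists s, (fun h => a h + (if h == g then c else 0)); split=> //.
  rewrite (big_rem g) //= [RHS](big_rem g) //= eqxx amullD comp_lfunDl.
  rewrite addrAC; congr (_ + _); rewrite !big_seq.
  apply: eq_bigr => h; rewrite mem_rem_uniq // inE => /andP[/negPf-> _].
  by rewrite addr0.
exists (g :: s), (fun h => if h == g then c else a h).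
split; rewrite /= ?sg ?Ag //.
rewrite big_cons eqxx addrC; congr (_ + _); rewrite !big_seq.
by apply: eq_bigr => h sh; case: eqP => // hg; rewrite hg sg in sh.
Qed.

Lemma skewD f1 f2 : skew_group_algebra f1 -> skew_group_algebra f2 ->
  skew_group_algebra (f1 + f2).
Proof.
move=> Sf1 [s [a [_ As ->]]]; elim: s f1 Sf1 As => [|g s IHs] f1 Sf1 /=.
  by rewrite big_nil addr0.
by case/andP=> Ag As; rewrite big_cons addrA; apply: IHs => //; apply: skewDt.
Qed.

Lemma skew_term g c : kAut 1 {:L} g -> skew_group_algebra (amull c \o g)%VF.
Proof. by move=> Ag; rewrite -[X in skew_group_algebra X]add0r; apply: skewDt skew0. Qed.

Lemma skew_comp f1 f2 : skew_group_algebra f1 -> skew_group_algebra f2 ->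
  skew_group_algebra (f1 \o f2)%VF.
Proof.
move=> [s [a [_ As ->]]] [t [b [_ At ->]]].
elim: s As => [|g s IHs] /=; first by rewrite big_nil comp_lfun0l => _; apply: skew0.
case/andP=> Ag /IHs{IHs}Ss; rewrite big_cons comp_lfunDl.
apply: skewD Ss; elim: t At => [|h t IHt] /=.
  by rewrite big_nil comp_lfun0r => _; apply: skew0.
case/andP=> Ah /IHt{IHt}St; rewrite big_cons comp_lfunDr; apply: skewD St.
suff ->: ((amull (a g) \o g) \o (amull (b h) \o h) =
          amull (a g * g (b h)) \o (g \o h))%VF.
  by apply: skew_term; move: Ag Ah; rewrite !kAutfE; apply: comp_kHom.
apply/lfunP=> x.
by rewrite comp_lfunE !amull_compE comp_lfunE (kAut1M Ag) mulrA.
Qed.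

Lemma skew_group_algebraP f :
  skew_group_algebra f <-> generated_subalgebra f.
Proof.
have amull1E : amull 1 = \1%VF :> 'End(L).
  by apply/lfunP=> x; rewrite !lfunE /= mul1r.
split=> [[s [a [_ As ->]]] | ].
  elim: s As => [|g s IHs] /=.
    rewrite big_nil => _; have <-: amull 0 = 0 :> 'End(L); last exact: gen_mull.
    by apply/lfunP=> x; rewrite !lfunE /= mul0r.
  case/andP=> Ag /IHs Gs; rewrite big_cons; apply: gen_add Gs.
  by apply: gen_comp; [apply: gen_mull | apply: gen_aut].
elim=> {f} [c | g Ag | f1 f2 _ S1 _ S2 | f1 f2 _ S1 _ S2].
- rewrite -[amull c]comp_lfun1r; apply: skew_term.
  by rewrite kAutfE kHom1.
- by rewrite -[g]comp_lfun1l -amull1E; apply: skew_term.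
- exact: skewD.
- exact: skew_comp.
Qed.

(* Dedekind's independence of automorphisms. *)
Lemma skew_group_algebra_direct s a : uniq s -> all (kAut 1 {:L}) s ->
  \sum_(g <- s) (amull (a g) \o g)%VF = 0 -> {in s, forall g, a g = 0}.
Proof.
have sumE (t : seq 'End(L)) (b : 'End(L) -> L) (x : L) :
    (\sum_(g <- t) (amull (b g) \o g)%VF) x = \sum_(g <- t) b g * g x.
  by rewrite sum_lfunE; apply: eq_bigr => g _; rewrite amull_compE.
elim: s a => // h s IHs a /= /andP[s'h Us] /andP[Ah As] S0.
have Sx x : a h * h x + \sum_(g <- s) a g * g x = 0.
  by rewrite -(big_cons _ _ h s xpredT (fun g => a g * g x)) -sumE S0 lfunE.
have as0 : {in s, forall g, a g = 0}.
  move=> g sg; have /lfunPn[y ne_y]: g != h by apply: contraNneq s'h => <-.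
  have /(IHs (fun k => a k * (k y - h y)) Us As)/(_ g sg)/eqP :
      \sum_(k <- s) (amull (a k * (k y - h y)) \o k)%VF = 0.
    apply/lfunP=> x; rewrite (sumE s (fun k => a k * (k y - h y))) lfunE /=.
    rewrite (_ : \sum_(k <- s) _ = \sum_(k <- s) a k * k (y * x)
                   - h y * \sum_(k <- s) a k * k x).
      have := Sx (y * x); rewrite (kAut1M Ah) => /eqP.
      rewrite addrC addr_eq0 => /eqP->.
      have /eqP := Sx x; rewrite addrC addr_eq0 => /eqP->.
      by rewrite mulrN opprK mulrCA addNr.
    rewrite mulr_sumr -sumrB !big_seq; apply: eq_bigr => k sk.
    rewrite (kAut1M (allP As k sk)) mulrBr mulrBl -!mulrA.
    by congr (_ - _); rewrite mulrCA.
  by rewrite mulf_eq0 subr_eq0 (negPf ne_y) orbF => /eqP.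
move=> g; rewrite inE => /predU1P[-> | /as0//].
have := Sx 1; rewrite (kAut1_1 Ah) mulr1 big1_seq ?addr0 //.
by move=> k /andP[_ /as0->]; rewrite mul0r.
Qed.

End SkewGroupAlgebra.

(* Main.v *)
Require Import Defs.
From HB Require Import structures.
From mathcomp Require Import all_boot all_order all_algebra all_field.

(* If L/K is Galois with primitive element x, whose conjugates g(x) are
   distinct, then the equations \sum_g a_g g(x)^i = f(x^i), i < [L : K], form a
   Vandermonde system in the a_g, so every f lies in the skew group algebra.
   Conversely, write a K-linear projection f of L onto K as \sum_g a_g g with
   all a_g nonzero.  As h f = f for every automorphism h, Dedekind's
   independence theorem shows that the support of f is stable under left
   multiplication by h.  If the support fixes y, then y = y f(1) = f(y) is
   in K.  Hence the product of the X - y, for y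
   ranging over the distinct conjugates of x, has coefficients in K and is a
   split separable multiple of the minimal polynomial of x. *)

Set Implicit Arguments.
Unset Strict Implicit.
Unset Printing Implicit Defensive.

Import GRing.Theory.
Local Open Scope ring_scope.

(** The Vandermonde matrix of pairwise distinct nodes is invertible. *)
Lemma power_sum_interpolation (F : fieldType) (r : seq F) (v : nat -> F) :
    uniq r ->
  exists c : F -> F,
    forall i, (i < size r)%N -> \sum_(y <- r) c y * y ^+ i = v i.
Proof.
move=> Ur; pose n := size r; pose V := Vandermonde n (\row_(j < n) r`_j).
have uV : V \in unitmx.
  rewrite unitmxE det_Vandermonde unitfE prodf_seq_neq0; apply/allP=> i _ /=.
  rewrite prodf_seq_neq0; apply/allP=> j _ /=; apply/implyP=> lt_ij.
  by rewrite !mxE subr_eq0 nth_uniq // neq_ltn lt_ij orbT.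
have [u Du] : exists u : 'cV_n, V *m u = \col_i v i.
  by exists (invmx V *m \col_i v i); rewrite mulKVmx.
(* The solution [u] is indexed by positions in [r]; it is read as a function of the node, with
   default 0 outside [r]. *)
exists (fun y => oapp (fun j : 'I_n => u j 0) 0 (insub (index y r))).
move=> i lt_i; rewrite (big_nth 0) big_mkord.
move/matrixP/(_ (Ordinal lt_i) 0): Du; rewrite !mxE /= => <-.
apply: eq_bigr => j _.
by rewrite index_uniq // (valK j) !mxE mulrC.
Qed.

Section GaloisSkew.

Variables (K : fieldType) (L : fieldExtType K).
Implicit Types (f g h : 'End(L)) (a : 'End(L) -> L) (s : seq 'End(L)).

Lemma skew_sumE s a x :
  (\sum_(g <- s) (amull (a g) \o g)%VF) x = \sum_(g <- s) a g * g x.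
Proof. by rewrite sum_lfunE; apply: eq_bigr => g _; rewrite amull_compE. Qed.

(** Elements of K(x) are K-combinations of the powers of [x] below its degree. *)
Lemma eq_lfun_powers f1 f2 x :
    (forall i, (i < adjoin_degree 1 x)%N -> f1 (x ^+ i) = f2 (x ^+ i)) ->
  {in <<1; x>>%VS, f1 =1 f2}.
Proof.
move=> eq12 z /Fadjoin_poly_eq <-.
rewrite (horner_coef_wide x (size_Fadjoin_poly _ _ _)) !linear_sum.
apply: eq_bigr => i _.
have /vlineP[k ->] := polyOverP (Fadjoin_polyOver 1 x z) i.
by rewrite mulr_algl !linearZ /= eq12.
Qed.

Lemma galois_skew f : galois_extension L -> skew_group_algebra f.
Proof.
case=> nL sL; set x := separable_generator 1 {:L}.
have EL : <<1; x>>%VS = {:L}%VS.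
  by rewrite [RHS](eq_adjoin_separable_generator sL) // sub1v.
have [r Dr] := nL x.
have Ur : uniq r.
  by rewrite -separable_prod_XsubC -Dr; apply: (separableP sL); rewrite memvf.
have szr : size r = adjoin_degree 1 x.
  by apply: succn_inj; rewrite -size_minPoly Dr size_prod_XsubC.
(* [g y] is the K-embedding of L = K(x) that sends [x] to the root [y]. *)
pose g y := kHomExtend 1 \1 x y.
have rt y : y \in r -> root (map_poly \1%VF (minPoly 1 x)) y.
  rewrite (kHom_poly_id (kHom1 1 {:L})) ?minPolyOver // Dr.
  by rewrite root_prod_XsubC.
have id1 : kHom 1 1 (\1%VF : 'End(L)) := kHom1 1 1.
have gx y : y \in r -> g y x = y by move/rt=> ry; apply: kHomExtend_val id1 ry.
have gA y : y \in r -> kAut 1 {:L} (g y).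
  by move/rt=> ry; rewrite kAutfE -EL; apply: kHomExtendP ry.
have [c Dc] := power_sum_interpolation (fun i => f (x ^+ i)) Ur.
(* An automorphism [h] is determined by the root [h x], so [c] transfers from roots to
   automorphisms. *)
exists (map g r), (fun h => c (h x)); split.
- rewrite map_inj_in_uniq // => y z ry rz eq_yz.
  by rewrite -(gx y ry) -(gx z rz) eq_yz.
- by apply/allP=> _ /mapP[y ry ->]; apply: gA.
apply/lfunP=> z; apply: (@eq_lfun_powers _ _ x); last by rewrite EL memvf.
move=> i; rewrite -szr => /Dc <-; rewrite skew_sumE big_map !big_seq.
apply: eq_bigr => y ry; rewrite gx //; congr (_ * _).
have /kHom_monoid_morphism[g1 gM] : kHom 1 {:L} (g y) by rewrite -kAutfE gA.
by elim: i => [|i IHi]; rewrite ?expr0 // !exprS gM gx // IHi.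
Qed.

(** Dedekind's theorem is applied to the difference of the two expansions, written over the union
    [u] of the supports with coefficients extended by 0. *)
Lemma skew_support_eq s t a b g :
    uniq s -> uniq t -> all (kAut 1 {:L}) s -> all (kAut 1 {:L}) t ->
    \sum_(g <- s) (amull (a g) \o g)%VF = \sum_(g <- t) (amull (b g) \o g)%VF ->
  g \in s -> g \notin t -> a g = 0.
Proof.
move=> Us Ut As At eq_st sg t'g.
pose u := s ++ [seq k <- t | k \notin s].
pose c k := (if k \in s then a k else 0) - (if k \in t then b k else 0).
have Uu : uniq u.
  rewrite cat_uniq Us filter_uniq // andbT; apply/hasPn=> k.
  by rewrite mem_filter => /andP[].
have Au : all (kAut 1 {:L}) u.
  rewrite all_cat As; apply/allP=> k.
  by rewrite mem_filter => /andP[_ /(allP At)].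
suff c0 : \sum_(k <- u) (amull (c k) \o k)%VF = 0.
  have := skew_group_algebra_direct Uu Au c0.
  by move/(_ g); rewrite mem_cat sg /c sg (negPf t'g) subr0 => ->.
apply/lfunP=> z; move/lfunP/(_ z): eq_st; rewrite !skew_sumE lfunE /= => eq_st.
rewrite big_cat big_filter /=.
have -> : \sum_(k <- s) c k * k z =
   \sum_(k <- s) a k * k z - \sum_(k <- s | k \in t) b k * k z.
  rewrite [X in _ - X]big_mkcond -sumrB !big_seq; apply: eq_bigr => k sk.
  by rewrite /c sk mulrBl; case: ifP => // _; rewrite mul0r.
have -> : \sum_(k <- t | k \notin s) c k * k z =
   - \sum_(k <- t | k \notin s) b k * k z.
  rewrite -sumrN big_seq_cond [RHS]big_seq_cond; apply: eq_bigr => k.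
  by case/andP=> tk /negPf s'k; rewrite /c s'k tk sub0r mulNr.
have -> : \sum_(k <- s | k \in t) b k * k z = \sum_(k <- t | k \in s) b k * k z.
  rewrite -big_filter -[RHS]big_filter; apply: perm_big.
  apply: uniq_perm; rewrite ?filter_uniq // => k.
  by rewrite !mem_filter andbC.
by rewrite eq_st [\sum_(k <- t) _](bigID (mem s)) /= addrAC addrK subrr.
Qed.

Lemma skew_proj_support : skew_group_algebra (projv 1%AS : 'End(L)) ->
  exists s, [/\ s != [::], all (kAut 1 {:L}) s,
    forall h, kAut 1 {:L} h -> {in s, forall g, (h \o g)%VF \in s}
  & forall y, {in s, forall g, g y = y} -> y \in 1%VS].
Proof.
case=> s0 [a [Us0 As0 D0]].
pose s := [seq g <- s0 | a g != 0].
have Us : uniq s by rewrite filter_uniq.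
have As : all (kAut 1 {:L}) s.
  by apply/allP=> g; rewrite mem_filter => /andP[_ /(allP As0)].
have Ds : projv 1%AS = \sum_(g <- s) (amull (a g) \o g)%VF :> 'End(L).
  apply/lfunP=> z; rewrite D0 !skew_sumE big_filter [RHS]big_mkcond.
  by apply: eq_bigr => g _; case: eqP => //= ->; rewrite mul0r.
have fixK y : {in s, forall g, g y = y} -> y \in 1%VS.
  move=> fix_y; suff <- : projv 1%AS y = y by apply: memv_proj.
  rewrite -[RHS]mulr1 -[in RHS](projv_id (mem1v 1%AS)).
  rewrite Ds !skew_sumE mulr_sumr !big_seq; apply: eq_bigr => g sg.
  by rewrite (kAut1_1 (allP As g sg)) fix_y // mulr1 mulrC.
exists s; split=> //.
  apply/eqP=> s_0; have /eqP := oner_neq0 L; apply.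
  by rewrite -(projv_id (mem1v 1%AS)) Ds s_0 big_nil lfunE.
move=> h Ah g sg; apply/negPn/negP=> s'hg.
have hK : kHom 1 {:L} h by rewrite -kAutfE.
have kerh := kAutf_lker0 hK.
have hVK k : (h^-1 \o (h \o k))%VF = k.
  by rewrite comp_lfunA lker0_compVf // comp_lfun1l.
(* Since h(a_l l(z)) = h(a_l) (h l)(z), these are the coefficients of h f, with f the projection; if
   [h \o g] were outside [s], h f = f would force h(a_g) = 0. *)
pose b k := h (a (h^-1 \o k)%VF).
suff /eqP : b (h \o g)%VF = 0.
  rewrite /b hVK; move: sg; rewrite mem_filter => /andP[ag _].
  by rewrite -(inj_eq (lker0P kerh)) linear0 in ag *; move/negPf: ag => ->.
apply: (@skew_support_eq [seq (h \o k)%VF | k <- s] s b a) => //.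
- by rewrite map_inj_uniq // => k l /(congr1 (comp_lfun h^-1)); rewrite !hVK.
- apply/allP=> _ /mapP[k sk ->]; rewrite kAutfE; apply: comp_kHom => //.
  by rewrite -kAutfE (allP As).
- rewrite -Ds; apply/lfunP=> z; rewrite skew_sumE big_map.
  have /vlineP[k Dk] := memv_proj 1%AS z.
  transitivity (h (projv 1%AS z)).
    rewrite Ds skew_sumE linear_sum; apply: eq_bigr => l _ /=.
    by rewrite /b hVK comp_lfunE (kAut1M Ah).
  by rewrite Dk linearZ /= (kAut1_1 Ah).
- exact: map_f.
Qed.

Lemma skew_minPoly (x : L) : skew_group_algebra (projv 1%AS : 'End(L)) ->
  exists2 r, uniq r & minPoly 1 x = \prod_(y <- r) ('X - y%:P).
Proof.
case/skew_proj_support=> s [ne_s As sM fixK].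
pose r := undup [seq (g : 'End(L)) x | g <- s].
pose p := \prod_(y <- r) ('X - y%:P).
have Kp : p \is a polyOver 1%VS.
  apply/polyOverP=> i; apply: fixK => h sh; have Ah := allP As h sh.
  have hK : kHom 1 {:L} h by rewrite -kAutfE.
  have hr : perm_eq [seq h y | y <- r] r.
    have Uhr : uniq [seq h y | y <- r].
      by rewrite map_inj_uniq ?undup_uniq //; apply/lker0P/kAutf_lker0/hK.
    apply: uniq_perm; rewrite ?undup_uniq //.
    (* An injective map of a finite set into itself is a permutation, so inclusion is enough. *)
    apply: (uniq_min_size Uhr _ _).2; last by rewrite size_map.
    move=> _ /mapP[y + ->]; rewrite !mem_undup => /mapP[g sg ->].
    by apply/mapP; exists (h \o g)%VF; rewrite ?sM ?comp_lfunE.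
  have hm : monoid_morphism h by apply/kHom_monoid_morphism.
  pose hRM := GRing.isMonoidMorphism.Build _ _ _ hm.
  pose hF : {rmorphism L -> L} := HB.pack (fun_of_lfun h) hRM.
  have: map_poly hF p = p.
    rewrite rmorph_prod -[RHS](perm_big _ hr) big_map.
    by apply: eq_bigr => y _; exact: (map_polyXsubC hF).
  by move/polyP/(_ i); rewrite coef_map.
have px : root p x.
  (* Take some [g] in the nonempty support: g(p(x)) = p(g(x)) = 0 because [p] is over K, and [g] is
     injective. *)
  case: s @r @p ne_s As Kp {sM fixK} => // g s r p _ /andP[Ag _] Kp.
  have gK : kHom 1 {:L} g by rewrite -kAutfE.
  rewrite rootE -(inj_eq (lker0P (kAutf_lker0 gK))) linear0.
  rewrite (kHom_horner gK) ?memvf //; last first.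
    by apply: polyOverSv Kp; apply: subvf.
  by rewrite (kHom_poly_id gK Kp) -rootE root_prod_XsubC mem_undup mem_head.
(* A divisor of a product of linear factors is, up to a scalar, a subproduct; both sides here are
   monic. *)
have /dvdp_prod_XsubC[m eq_m] := minPoly_dvdp Kp px.
exists (mask m r); first by rewrite mask_uniq ?undup_uniq.
by apply/eqP; rewrite -eqp_monic ?monic_minPoly ?monic_prod_XsubC.
Qed.

End GaloisSkew.

Theorem proposition5p12 (K : fieldType) (L : fieldExtType K) :
  galois_extension L <-> (forall f : 'End(L), skew_group_algebra f).
Proof.
split=> [galL f | skewL]; first exact: galois_skew.
split=> [x | ].
  by have [r _ Dr] := skew_minPoly x (skewL _); exists r.
apply/separableP=> x _; have [r Ur Dr] := skew_minPoly x (skewL _).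
by rewrite /separable_element Dr separable_prod_XsubC.
Qed.
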